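(* Let $I=\{1,\dots,n\}$ and $J=\{1,\dots,m\}$ with $n,m\ge 1$, let $A=(a_{ij})_{n\times m}$ be a matrix with $a_{ij}\in[0,1]$ for all $i\in I$, $j\in J$, and let $x=(x_1,\dots,x_n)\in[0,1]^n$. (a) If $\max(x_i,a_{ij})=1$ for all $i\in I$ and all $j\in J$, then for every $j\in J$ $$\max_{i=1}^{n}\{\min(x_i,a_{ij})\}=\max_{i=1}^{n}\{1-|x_i-a_{ij}|\}.$$ (b) Suppose that for every $j\in J$ $$\max_{i=1}^{n}\{\min(x_i,a_{ij})\}=\max_{i=1}^{n}\{1-|x_i-a_{ij}|\}.$$ Then for each $j\in J$ there exists at least one $i_j\in I$ such that $\max(x_{i_j},a_{i_j j})=1$. *)

(* Defs.v *)
From mathcomp Require Import all_boot all_order all_algebra.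
From mathcomp Require Import reals.

Set Implicit Arguments.
Unset Strict Implicit.
Unset Printing Implicit Defensive.

Import Order.TTheory GRing.Theory Num.Theory.

Local Open Scope ring_scope.

(* The iterated maximum is seeded with a value of F itself, which [0 < n] makes
   available: [fmax hn F] is the greatest of the F i, with no artificial default
   value entering the comparison. *)
Definition fmax (R : realType) (n : nat) (hn : (0 < n)%N) (F : 'I_n -> R) : R :=
  \big[Num.max/F (Ordinal hn)]_(i < n) F i.

(* Main.v *)
(* Since max(u,v) - min(u,v) = |u - v|, we have 1 - |u - v| = min(u,v) + (1 - max(u,v)).
   So both sides of (a) agree termwise, and at an index attaining the maximum of the
   min(x_i, a_ij) the equality in (b) forces 1 - max(x_i, a_ij) <= 0. *)
Require Import Defs.
From mathcomp Require Import all_boot all_order all_algebra.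
From mathcomp Require Import reals.
From mathcomp Require Import lra.

Import Order.TTheory GRing.Theory Num.Theory.

Local Open Scope ring_scope.

Lemma subr1_dist_minr {R : realDomainType} (u v : R) :
  1 - `|u - v| = Num.min u v + (1 - Num.max u v).
Proof.
case: (leP u v) => h; first by rewrite ler0_norm; lra.
by rewrite gtr0_norm; lra.
Qed.

Lemma eq_fmax {R : realType} {n : nat} (hn : (0 < n)%N) (F G : 'I_n -> R) :
  F =1 G -> fmax hn F = fmax hn G.
(* [FG] rewrites the seed, the only occurrence of [F] outside the binder; [eq_bigr] handles the
   terms. *)
Proof. by move=> FG; rewrite /fmax FG; apply: eq_bigr. Qed.

Lemma le_fmax {R : realType} {n : nat} (hn : (0 < n)%N) (F : 'I_n -> R)
  (i : 'I_n) : F i <= fmax hn F.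
Proof. exact: le_bigmax. Qed.

(** Being a value of [F] holds for the seed, taken at [Ordinal hn], and passes to [Num.max], which
    returns one of its arguments. *)
Lemma fmax_attained {R : realType} {n : nat} (hn : (0 < n)%N) (F : 'I_n -> R) :
  exists i, fmax hn F = F i.
Proof.
rewrite /fmax; apply: (big_ind (fun y => exists i, y = F i)).
- by exists (Ordinal hn).
- by move=> y z [i ->] [k ->]; case: leP => _; [exists k | exists i].
- by move=> i _; exists i.
Qed.

Theorem lemma2 (R : realType) (n m : nat) (hn : (0 < n)%N) (hm : (0 < m)%N)
    (A : 'M[R]_(n, m)) (x : 'rV[R]_n)
    (hA : forall (i : 'I_n) (j : 'I_m), 0 <= A i j <= 1)
    (hx : forall i : 'I_n, 0 <= x 0 i <= 1) :
  ((forall (i : 'I_n) (j : 'I_m), Num.max (x 0 i) (A i j) = 1) ->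
   forall j : 'I_m,
     fmax hn (fun i => Num.min (x 0 i) (A i j)) =
     fmax hn (fun i => 1 - `|x 0 i - A i j|))
  /\
  ((forall j : 'I_m,
     fmax hn (fun i => Num.min (x 0 i) (A i j)) =
     fmax hn (fun i => 1 - `|x 0 i - A i j|)) ->
   forall j : 'I_m, exists i : 'I_n, Num.max (x 0 i) (A i j) = 1).
Proof.
split=> [max1 j | fmaxE j].
  by apply: eq_fmax => i; rewrite subr1_dist_minr max1 subrr addr0.
have [i fmaxi] := fmax_attained hn (fun i => Num.min (x 0 i) (A i j)).
(* The upper bounds in [hx] and [hA] give max <= 1, leaving 1 <= max. *)
exists i; apply/eqP; rewrite eq_le ge_max.
have /andP[_ ->] := hx i; have /andP[_ ->] /= := hA i j.
(* The bound on the term at [i] becomes min + (1 - max) <= min, since both maxima equal the min at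
   [i]. *)
have := le_fmax hn (fun i => 1 - `|x 0 i - A i j|) i.
by rewrite -fmaxE fmaxi subr1_dist_minr gerDl subr_le0.
Qed.
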